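(* Let $\Omega$ be a compact subset of $\mathbb{R}^n$ with $0\in\Omega$, and suppose $f\in\mathcal{C}(\Omega,\mathbb{R}^n)$, $V\in\mathcal{C}(\Omega,[0,1])$, $W\in\mathcal{C}(\Omega,\mathbb{R}^n)$, and $\Psi\in\mathcal{C}(\Omega\times\Lambda,\mathbb{R})$, where $\Lambda\subset\mathbb{R}$ contains $[0,1]$. Assume that $f(0)=0$, that $\Psi(x,\cdot)$ is $L$-Lipschitz with constant $L>0$ uniformly for $x\in\Omega$, and that the following conditions are satisfied: (i) for all $x\in\Omega$: $W(x)=0\iff x=0$; (ii) $\lim_{x\to0}\frac{\|f(x)\|}{\|W(x)\|}<\infty$; (iii) for all $z\in\Lambda$: $\Psi(0,z)=0$; (iv) for all $x\in\Omega$: $W(x)^\top f(x)=\|W(x)\|\,\Psi(x,V(x))$. Furthermore, suppose that for any $\delta>0$ there exist $\tilde f\in\mathcal{C}(\Omega,\mathbb{R}^n)$, $\hat V\in\mathcal{C}(\Omega,\mathbb{R})$, $\hat W\in\mathcal{C}(\Omega,\mathbb{R}^n)$ such that $$\|f-\tilde f\|_{\mathcal{C}(\Omega)}\le\delta,\quad \|V-\hat V\|_{\mathcal{C}(\Omega)}\le\delta,\quad \|W-\hat W\|_{\mathcal{C}(\Omega)}\le\delta,$$ where $\tilde f(0)=0$, $\hat V(\Omega)\subset\Lambda$, and for all $x\in\Omega$: $\hat W(x)=0\iff x=0$. Then, for any $\varepsilon>0$ there exist such $\tilde f$, $\hat W$, and $\hat V$ such that, for $\hat v:\Omega\to\mathbb{R}^n$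 defined by $\hat v(x)=\hat W(x)/\|\hat W(x)\|$ if $\hat W(x)\ne0$ and $\hat v(x)=0$ otherwise, and $\Psi_{\hat V}:\Omega\to\mathbb{R}$ defined by $\Psi_{\hat V}(x)=\Psi(x,\hat V(x))$, the function $\hat f:\Omega\to\mathbb{R}^n$ defined by $$\hat f\triangleq\tilde f-\hat v\hat v^\top\tilde f+\hat v\,\Psi_{\hat V}$$ is in $\mathcal{C}(\Omega,\mathbb{R}^n)$ and satisfies $\|f-\hat f\|_{\mathcal{C}(\Omega)}\le\varepsilon$.
   Context: $\mathcal{C}(D,R)$ denotes the continuous functions from $D$ to $R$; $\|\cdot\|$ is the Euclidean norm; $\|g\|_{\mathcal{C}(\Omega)}=\sup_{x\in\Omega}\|g(x)\|$. *)

(* Defs.v *)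
(* MathComp / MathComp-Analysis. *)
From HB Require Import structures.
From mathcomp Require Import all_boot all_order all_algebra.
From mathcomp Require Import all_classical all_reals all_analysis.

Set Implicit Arguments.
Unset Strict Implicit.
Unset Printing Implicit Defensive.

Import Order.TTheory GRing.Theory Num.Theory.
Import numFieldNormedType.Exports.

Local Open Scope classical_set_scope.
Local Open Scope ring_scope.

(* The library norm on matrices is the sup norm; it induces the same topology
   on 'cV[R]_n, but the quantities below are Euclidean. *)
Definition enorm (R : realType) (n : nat) (u : 'cV[R]_n) : R :=
  Num.sqrt (\sum_(i < n) u i 0 ^+ 2).

(* sup_{x in D} N (g x), taken in \bar R so that an unbounded family has
   value +oo rather than a default value. *)
Definition supnorm (R : realType) (T E : Type) (N : E -> R) (D : set T)
    (g : T -> E) : \bar R :=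
  ereal_sup [set (N (g x))%:E | x in D].

(* A function on Omega is a total function on 'cV[R]_n of which only the values
   on Omega matter: continuity is for the subspace topology of Omega. *)
Definition approximants (R : realType) (n : nat) (Omega : set 'cV[R]_n)
    (Lambda : set R) (f : 'cV[R]_n -> 'cV[R]_n) (V : 'cV[R]_n -> R)
    (W : 'cV[R]_n -> 'cV[R]_n) (delta : R)
    (ftil : 'cV[R]_n -> 'cV[R]_n) (Vhat : 'cV[R]_n -> R)
    (What : 'cV[R]_n -> 'cV[R]_n) : Prop :=
  [/\ [/\ {within Omega, continuous ftil},
          {within Omega, continuous Vhat} &
          {within Omega, continuous What}],
      [/\ (supnorm (@enorm R n) Omega (fun x => (f x - ftil x)%R) <= delta%:E)%E,
          (supnorm Num.norm Omega (fun x => (V x - Vhat x)%R) <= delta%:E)%E &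
          (supnorm (@enorm R n) Omega (fun x => (W x - What x)%R) <= delta%:E)%E],
      ftil 0 = 0,
      Vhat @` Omega `<=` Lambda &
      forall x, Omega x -> (What x = 0 <-> x = 0)].

Definition vhat (R : realType) (n : nat) (What : 'cV[R]_n -> 'cV[R]_n)
    (x : 'cV[R]_n) : 'cV[R]_n :=
  if What x == 0 then 0 else (enorm (What x))^-1 *: What x.

Definition fhat (R : realType) (n : nat) (Psi : 'cV[R]_n * R -> R)
    (ftil : 'cV[R]_n -> 'cV[R]_n) (Vhat : 'cV[R]_n -> R)
    (What : 'cV[R]_n -> 'cV[R]_n) (x : 'cV[R]_n) : 'cV[R]_n :=
  ftil x - vhat What x *m (vhat What x)^T *m ftil x
    + Psi (x, Vhat x) *: vhat What x.

(* Main.v *)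
(* On Omega one has f = f - v v^T f + v Psi_V with v = W / |W|, so
   f - fhat = (f - ftil) - vhat vhat^T (f - ftil) + vhat (vhat^T f - Psi_Vhat).
   The first two terms are at most delta each, and
   vhat^T f - Psi_Vhat = (vhat - v)^T f + (Psi_V - Psi_Vhat), whose second part
   is at most L delta. For the first part, (ii) and compactness give |f| <= K |W|
   on Omega, while |W| |vhat - v| <= 2 |W - What| <= 2 delta. Hence
   |f - fhat| <= (2 + 2 K + L) delta. Although vhat is discontinuous at 0, fhat is
   continuous there because |fhat| <= 2 |ftil| + |Psi_Vhat|, which tends to 0. *)

Require Import Defs.
From mathcomp Require Import all_boot all_order all_algebra.
From mathcomp Require Import all_classical all_reals all_analysis.
From mathcomp Require Import ring lra.

Set Implicit Arguments.
Unset Strict Implicit.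
Unset Printing Implicit Defensive.

Import Order.TTheory GRing.Theory Num.Theory.
Import numFieldNormedType.Exports.

Local Open Scope classical_set_scope.
Local Open Scope ring_scope.

(** * Euclidean inner product and norm on column vectors *)

Section Euclidean.
Context {R : realType} {n : nat}.
Implicit Types u v w : 'cV[R]_n.

Definition dotp u v : R := (u^T *m v) 0 0.

Lemma dotpE u v : dotp u v = \sum_i u i 0 * v i 0.
Proof. by rewrite /dotp mxE; apply: eq_bigr => i _; rewrite mxE. Qed.

Lemma dotpC u v : dotp u v = dotp v u.
Proof. by rewrite !dotpE; apply: eq_bigr => i _; rewrite mulrC. Qed.

Lemma dotpDr u v w : dotp u (v + w) = dotp u v + dotp u w.
Proof. by rewrite /dotp mulmxDr mxE. Qed.

Lemma dotpZr a u v : dotp u (a *: v) = a * dotp u v.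
Proof. by rewrite /dotp -scalemxAr mxE. Qed.

Lemma dotpDl u v w : dotp (u + v) w = dotp u w + dotp v w.
Proof. by rewrite dotpC dotpDr !(dotpC w). Qed.

Lemma dotpZl a u v : dotp (a *: u) v = a * dotp u v.
Proof. by rewrite dotpC dotpZr dotpC. Qed.

Lemma dotp0l v : dotp 0 v = 0.
Proof. by rewrite -(scale0r v) dotpZl mul0r. Qed.

Lemma dotp_ge0 u : 0 <= dotp u u.
Proof. by rewrite dotpE sumr_ge0// => i _; rewrite -expr2 sqr_ge0. Qed.

Lemma enorm_sqr u : enorm u ^+ 2 = dotp u u.
Proof.
rewrite sqr_sqrtr ?dotpE; first by apply: eq_bigr => i _; rewrite expr2.
by apply: sumr_ge0 => i _; rewrite sqr_ge0.
Qed.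

Lemma enorm_ge0 u : 0 <= enorm u.
Proof. exact: sqrtr_ge0. Qed.

Lemma coord_le_enorm u i : `|u i 0| <= enorm u.
Proof.
rewrite -(@ler_pXn2r _ 2) ?nnegrE ?enorm_ge0// enorm_sqr dotpE (bigD1 i)//=.
rewrite real_normK ?num_real// -expr2 lerDl sumr_ge0// => j _.
by rewrite -expr2 sqr_ge0.
Qed.

(** Links the Euclidean norm to the sup norm that defines the topology: smallness of [enorm] forces
    convergence. *)
Lemma norm_le_enorm u : `|u| <= enorm u.
Proof.
rewrite /Num.norm/= mx_normrE; apply: bigmax_le => [|[i j] _ /=].
  exact: enorm_ge0.
by rewrite (ord1 j) coord_le_enorm.
Qed.

Lemma enorm_eq0 u : (enorm u == 0) = (u == 0).
Proof.
apply/eqP/eqP => [u0|->]; last first.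
  by apply/eqP; rewrite -sqrf_eq0 enorm_sqr dotp0l.
by apply/eqP; rewrite -normr_le0 -u0 norm_le_enorm.
Qed.

Lemma enorm0 : enorm (0 : 'cV[R]_n) = 0.
Proof. by apply/eqP; rewrite enorm_eq0. Qed.

Lemma enorm_gt0 u : (0 < enorm u) = (u != 0).
Proof. by rewrite lt_def enorm_ge0 andbT enorm_eq0. Qed.

Lemma enormZ a u : enorm (a *: u) = `|a| * enorm u.
Proof.
apply/eqP; rewrite -(@eqrXn2 _ 2) ?mulr_ge0 ?enorm_ge0//.
by rewrite exprMn !enorm_sqr dotpZl dotpZr real_normK ?num_real// mulrA.
Qed.

Lemma enormN u : enorm (- u) = enorm u.
Proof. by rewrite -scaleN1r enormZ normrN1 mul1r. Qed.

Lemma enormBC u v : enorm (u - v) = enorm (v - u).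
Proof. by rewrite -enormN opprB. Qed.

(** Cauchy-Schwarz: with a = |u| and b = |v|, the squared norm of b u - a v is 2ab(ab - u.v), which
    is nonnegative, and ab > 0 can be divided out. *)
Lemma ler_dotp u v : dotp u v <= enorm u * enorm v.
Proof.
have [->|u0] := eqVneq u 0; first by rewrite dotp0l enorm0 mul0r.
have [->|v0] := eqVneq v 0; first by rewrite dotpC dotp0l enorm0 mulr0.
have ab : 0 < enorm u * enorm v by rewrite mulr_gt0 ?enorm_gt0.
have := dotp_ge0 (enorm v *: u + (- enorm u) *: v).
rewrite !(dotpDl, dotpDr, dotpZl, dotpZr) -!enorm_sqr (dotpC v u) => h.
rewrite -subr_ge0 -(pmulr_rge0 _ ab).
set a := enorm u in h *; set b := enorm v in h *; set c := dotp u v in h *.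
by lra.
Qed.

Lemma normr_dotp u v : `|dotp u v| <= enorm u * enorm v.
Proof.
rewrite ler_norml ler_dotp andbT lerNl -mulN1r -dotpZl.
by rewrite scaleN1r (le_trans (ler_dotp _ _))// enormN.
Qed.

Lemma enormD u v : enorm (u + v) <= enorm u + enorm v.
Proof.
rewrite -(@ler_pXn2r _ 2) ?nnegrE ?addr_ge0 ?enorm_ge0//.
rewrite sqrrD !enorm_sqr dotpDl !dotpDr (dotpC v u) addrA lerD2r -addrA lerD2l.
by rewrite -mulr2n lerMn2r ler_dotp.
Qed.

Lemma enormB u v : enorm (u - v) <= enorm u + enorm v.
Proof. by rewrite (le_trans (enormD _ _))// enormN. Qed.

Lemma enorm_dist u v : `|enorm u - enorm v| <= enorm (u - v).
Proof.
have d u' v' : enorm u' - enorm v' <= enorm (u' - v').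
  by rewrite lerBlDr -{1}(subrK v' u') enormD.
by rewrite ler_norml d andbT lerNl opprB enormBC d.
Qed.

Lemma enorm_continuous : continuous (@enorm R n).
Proof.
move=> u; apply: (@continuous_comp _ _ _ _ Num.sqrt); last exact: sqrt_continuous.
apply: (@cvg_big R 'I_n +%R 0 xpredT (@add_continuous R) _ (nbhs u)) => i _.
have c := @coord_continuous R n 1 i 0 u.
by apply: (@cvgM _ _ (nbhs u)).
Qed.

Lemma cvg_enorm {T} (F : set_system T) {FF : Filter F} (g : T -> 'cV[R]_n) u :
  g @ F --> u -> enorm (g x) @[x --> F] --> enorm u.
Proof. by apply: continuous_cvg; exact: enorm_continuous. Qed.

Lemma cvg_dotp {T} (F : set_system T) {FF : Filter F} (g h : T -> 'cV[R]_n) a b :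
  g @ F --> a -> h @ F --> b -> dotp (g x) (h x) @[x --> F] --> dotp a b.
Proof.
move=> ga hb; rewrite dotpE; under eq_fun do rewrite dotpE.
apply: (@cvg_big R 'I_n +%R 0 xpredT (@add_continuous R)) => i _.
apply: cvgM; apply: (continuous_cvg FF (h := fun M : 'cV[R]_n => M i 0)) => //;
  exact: coord_continuous.
Qed.

End Euclidean.

Lemma supnorm_leP (R : realType) T E (N : E -> R) (D : set T) (g : T -> E) (d : R) :
  (supnorm N D g <= d%:E)%E <-> forall x, D x -> N (g x) <= d.
Proof.
split=> [h x Dx|h].
  by rewrite -lee_fin (le_trans _ h)//; apply: ereal_sup_ubound; exists x.
by apply: ge_ereal_sup => _ [x Dx <-]; rewrite lee_fin h.
Qed.

(** * Pointwise estimates for [vhat] and [fhat] *)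

Section Vhat.
Context {R : realType} {n : nat}.
Variables (Psi : 'cV[R]_n * R -> R) (ftil : 'cV[R]_n -> 'cV[R]_n).
Variables (Vhat : 'cV[R]_n -> R) (What : 'cV[R]_n -> 'cV[R]_n).

Lemma vhatE x : vhat What x = (enorm (What x))^-1 *: What x.
Proof. by rewrite /vhat; case: eqVneq => // ->; rewrite scaler0. Qed.

Lemma vhatK x : enorm (What x) *: vhat What x = What x.
Proof.
rewrite vhatE; have [->|W0] := eqVneq (What x) 0; first by rewrite !scaler0.
by rewrite scalerA divff ?scale1r// enorm_eq0.
Qed.

Lemma enorm_vhat x : enorm (vhat What x) <= 1.
Proof.
rewrite /vhat; have [_|W0] := eqVneq; first by rewrite enorm0.
by rewrite enormZ ger0_norm ?invr_ge0 ?enorm_ge0// mulVf// enorm_eq0.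
Qed.

(** The product [vhat^T *m ftil] is a 1 by 1 matrix, hence a scalar, so both corrections of [ftil]
    lie along [vhat]. *)
Lemma fhatE x : fhat Psi ftil Vhat What x =
  ftil x + (Psi (x, Vhat x) - dotp (vhat What x) (ftil x)) *: vhat What x.
Proof.
rewrite /fhat -mulmxA [_^T *m _]mx11_scalar mul_mx_scalar scalerBl.
by rewrite addrAC addrA.
Qed.

Lemma vhat_scale_le a x : enorm (a *: vhat What x) <= `|a|.
Proof. by rewrite enormZ ler_piMr// enorm_vhat. Qed.

Lemma dotp_vhat_le u x : `|dotp (vhat What x) u| <= enorm u.
Proof.
by rewrite (le_trans (normr_dotp _ _))// ler_piMl ?enorm_ge0// enorm_vhat.
Qed.

Lemma fhat_eq0 x : ftil x = 0 -> What x = 0 -> fhat Psi ftil Vhat What x = 0.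
Proof. by move=> f0 W0; rewrite fhatE f0 vhatE W0 !scaler0 addr0. Qed.

(** The bound does not involve the direction of [vhat], so it survives the discontinuity of [vhat]
    at the origin. *)
Lemma enorm_fhat x : enorm (fhat Psi ftil Vhat What x) <=
  enorm (ftil x) + (`|Psi (x, Vhat x)| + enorm (ftil x)).
Proof.
rewrite fhatE (le_trans (enormD _ _))// lerD2l (le_trans (vhat_scale_le _ _))//.
by rewrite (le_trans (ler_normB _ _))// lerD2l dotp_vhat_le.
Qed.

(** Since |What| vhat = What, even where [What] vanishes, the vector splits as (|w| - |What|) vhat -
    (w - What). The reverse triangle inequality bounds each term by |w - What|. *)
Lemma enorm_scale_vhat_sub w x :
  enorm (enorm w *: vhat What x - w) <= enorm (w - What x) *+ 2.
Proof.
have -> : enorm w *: vhat What x - w =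
    (enorm w - enorm (What x)) *: vhat What x - (w - What x).
  by rewrite scalerBl vhatK opprB addrA subrK.
rewrite (le_trans (enormB _ _))// mulr2n lerD2r.
by rewrite (le_trans (vhat_scale_le _ _))// enorm_dist.
Qed.

(** Here [u], [w], [psi] stand for the values of f, W and Psi_V at [x]. *)
Lemma fhat_dist u w psi x K L d : w != 0 -> enorm u <= K * enorm w ->
  dotp w u = enorm w * psi -> `|psi - Psi (x, Vhat x)| <= L * d ->
  enorm (u - ftil x) <= d -> enorm (w - What x) <= d ->
  enorm (u - fhat Psi ftil Vhat What x) <= (2 + 2 * K + L) * d.
Proof.
move=> w0 uK wu psid ud wd; set v := vhat What x.
have wgt0 : 0 < enorm w by rewrite enorm_gt0.
(* After multiplication by |w|, the quantity becomes (|w| vhat - w).u, because |w| psi = w.u.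
   Cauchy-Schwarz bounds it by 2d times K|w|, and |w| cancels. *)
have vu : `|dotp v u - psi| <= 2 * K * d.
  rewrite -(ler_pM2l wgt0) -[X in X * `|_|]gtr0_norm// -normrM mulrBr -wu.
  rewrite -dotpZl -mulN1r -dotpZl scaleN1r -dotpDl.
  rewrite (le_trans (normr_dotp _ _))//.
  rewrite [leRHS](_ : _ = (d *+ 2) * (K * enorm w)); last by ring.
  rewrite ler_pM ?enorm_ge0// (le_trans (enorm_scale_vhat_sub _ _))//.
  by rewrite lerMn2r.
have -> : u - fhat Psi ftil Vhat What x = (u - ftil x) +
    ((dotp v u - psi) + (psi - Psi (x, Vhat x)) - dotp v (u - ftil x)) *: v.
  rewrite fhatE -/v opprD addrA -scaleNr; congr (_ + _ *: _).
  by rewrite dotpDr -[- ftil x]scaleN1r dotpZr; ring.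
rewrite (le_trans (enormD _ _))// (le_trans (lerD ud (vhat_scale_le _ _)))//.
rewrite [leRHS](_ : _ = d + (2 * K * d + L * d + d)); last by ring.
rewrite lerD2l (le_trans (ler_normB _ _))// lerD//.
  by rewrite (le_trans (ler_normD _ _))// lerD.
by rewrite (le_trans (dotp_vhat_le _ _)).
Qed.

End Vhat.

(** * Compactness and continuity on [Omega] *)

Section Within.
Context {R : realType} {n : nat}.
Variable Omega : set 'cV[R]_n.

(** The quotient is locally bounded: near 0 by its limit, elsewhere by continuity. Compactness turns
    the local bounds into a single [K]. *)
Lemma enorm_ratio_bound (f W : 'cV[R]_n -> 'cV[R]_n) (l : R) :
  compact Omega -> {within Omega, continuous f} -> {within Omega, continuous W} ->
  f 0 = 0 -> (forall x, Omega x -> (W x = 0 <-> x = 0)) ->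
  (fun x => enorm (f x) / enorm (W x)) @ within Omega (0 : 'cV[R]_n)^' --> l ->
  exists2 K, 0 <= K & forall x, Omega x -> enorm (f x) <= K * enorm (W x).
Proof.
move=> cO fc Wc f0 W0 lim.
pose q x := enorm (f x) / enorm (W x).
have fq x K : Omega x -> q x <= K -> enorm (f x) <= K * enorm (W x).
  case: (eqVneq x 0) => [->|x0] Ox.
    by rewrite f0 (W0 _ Ox).2 ?enorm0 ?mulr0.
  by rewrite ler_pdivrMr// enorm_gt0; apply: contraNN x0 => /eqP/(W0 _ Ox)->.
have loc x : Omega x ->
    exists k, \forall y \near x, Omega y -> y != 0 -> q y <= k.
  move=> Ox; have [->|x0] := eqVneq x 0.
    exists (l + 1).
    have FF : Filter (0 : 'cV[R]_n)^' by exact: within_filter.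
    have ll : l < l + 1 by rewrite ltrDl.
    have : \forall y \near (0 : 'cV[R]_n), y != 0 -> Omega y -> q y < l + 1.
      exact: (cvgr_lt l lim _ ll).
    by apply: filterS => y h Oy y0; apply/ltW/h.
  have Wx0 : enorm (W x) != 0.
    by rewrite enorm_eq0; apply: contraNN x0 => /eqP/(W0 _ Ox)->.
  exists (q x + 1).
  have ll : q x < q x + 1 by rewrite ltrDl.
  have qc : q y @[y --> within Omega (nbhs x)] --> q x.
    move/subspace_continuousP : fc => /(_ x Ox) fc.
    move/subspace_continuousP : Wc => /(_ x Ox) Wc.
    by apply: cvgM; [exact: cvg_enorm|apply: cvgV => //; exact: cvg_enorm].
  have : \forall y \near x, Omega y -> q y < q x + 1 by exact: (cvgr_lt _ qc _ ll).
  by apply: filterS => y h Oy _; apply/ltW/h.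
(* Compactness in its near-covering form, with [K] tending to infinity as parameter: every point has
   a neighbourhood on which all large [K] work, so all large [K] work on the whole of [Omega]. *)
have : \forall K \near +oo, Omega `<=` [set x | enorm (f x) <= K * enorm (W x)].
  move/compact_near_coveringP/near_covering_withinP : cO; apply => x Ox.
  have [k kP] := loc x Ox.
  exists ([set y | Omega y -> y != 0 -> q y <= k], [set K | k <= K]) => /=.
    by split=> //; apply: nbhs_pinfty_ge; rewrite num_real.
  (* The local bounds leave out the origin, where both sides of the inequality vanish. *)
  move=> [y K] /= [qk kK] Oy; case: (eqVneq y 0) Oy => [->|y0] Oy.
    by rewrite f0 (W0 _ Oy).2 ?enorm0 ?mulr0.
  by apply: fq => //; apply: le_trans kK; apply: qk.
(* Every [K] above the threshold [M] works; this choice is also nonnegative. *)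
move=> [M [_ MP]]; exists (`|M| + 1); first by rewrite addr_ge0.
by apply: MP; rewrite (le_lt_trans (ler_norm M))// ltrDl.
Qed.

Lemma within_fhat_continuous (Lambda : set R) (Psi : 'cV[R]_n * R -> R)
    (ftil : 'cV[R]_n -> 'cV[R]_n) (Vhat : 'cV[R]_n -> R)
    (What : 'cV[R]_n -> 'cV[R]_n) :
  {within Omega `*` Lambda, continuous Psi} ->
  (forall z, Lambda z -> Psi (0, z) = 0) ->
  {within Omega, continuous ftil} -> {within Omega, continuous Vhat} ->
  {within Omega, continuous What} -> ftil 0 = 0 -> Vhat @` Omega `<=` Lambda ->
  (forall x, Omega x -> (What x = 0 <-> x = 0)) ->
  {within Omega, continuous (fhat Psi ftil Vhat What)}.
Proof.
move=> /subspace_continuousP Pc P0 /subspace_continuousP fc.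
move=> /subspace_continuousP Vc /subspace_continuousP Wc f0 VL W0.
apply/subspace_continuousP => x Ox; rewrite /from_subspace.
have {}fc : ftil y @[y --> within Omega (nbhs x)] --> ftil x by exact: fc.
have {}Wc : What y @[y --> within Omega (nbhs x)] --> What x by exact: Wc.
have {}Vc : Vhat y @[y --> within Omega (nbhs x)] --> Vhat x by exact: Vc.
have LV y : Omega y -> Lambda (Vhat y) by move=> Oy; apply: VL; exists y.
(* [Psi] is continuous only relative to [Omega] times [Lambda]; the pair (y, Vhat y) stays in that
   set because [Vhat] maps [Omega] into [Lambda]. *)
have {}Pc : Psi (y, Vhat y) @[y --> within Omega (nbhs x)] --> Psi (x, Vhat x).
  apply: (cvg_comp _ _ _ (Pc (x, Vhat x) _)); last by split=> //; exact: LV.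
  move=> U /= UP.
  have : (y, Vhat y) @[y --> within Omega (nbhs x)] --> (x, Vhat x).
    by apply: (cvg_pair (G := nbhs x) (H := nbhs (Vhat x))) => //; exact: cvg_within.
  move=> /(_ _ UP) UxV.
  have : \forall y \near x, Omega y ->
    (Omega `*` Lambda) (y, Vhat y) -> U (y, Vhat y) by exact: UxV.
  apply: filterS => y h Oy; apply: h => //.
  by split=> //; exact: LV.
case: (eqVneq x 0) => [x0|x0].
  subst x; have Wx0 : What 0 = 0 by apply/W0.
  rewrite fhat_eq0//; rewrite f0 in fc; rewrite P0 in Pc; last exact: LV.
  (* At the origin the norm of [fhat] is squeezed between 0 and the bound of [enorm_fhat], whose
     terms all tend to 0. *)
  apply/norm_cvg0P.
  apply: (@squeeze_cvgr _ _ _ _ (cst 0) (fun y => enorm (ftil y) +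
    (`|Psi (y, Vhat y)| + enorm (ftil y)))).
  - by apply: nearW => y; rewrite normr_ge0 (le_trans (norm_le_enorm _))// enorm_fhat.
  - exact: cvg_cst.
  rewrite [X in _ --> X](_ : 0 = enorm (0 : 'cV[R]_n) + (`|0 : R| + enorm (0 : 'cV[R]_n))).
    by apply: cvgD; [exact: cvg_enorm|apply: cvgD; [exact: cvg_norm|exact: cvg_enorm]].
  by rewrite enorm0 normr0 !addr0.
(* Away from the origin the normalisation is continuous, and [fhat] is built from continuous
   operations. *)
have Wx0 : enorm (What x) != 0.
  by rewrite enorm_eq0; apply: contraNN x0 => /eqP/(W0 _ Ox)->.
have vc : vhat What y @[y --> within Omega (nbhs x)] --> vhat What x.
  rewrite (_ : vhat What = fun y => (enorm (What y))^-1 *: What y); last first.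
    by apply/funext => y; exact: vhatE.
  by apply: cvgZ => //; apply: cvgV => //; exact: cvg_enorm.
rewrite (funext (fhatE Psi ftil Vhat What)).
by apply: cvgD => //; apply: cvgZ => //; apply: cvgB => //; exact: cvg_dotp.
Qed.

End Within.

(* A is an arbitrary class from which the approximants are drawn, so that "such"
   in the conclusion refers to the approximants provided by the hypothesis;
   with A := fun _ _ _ => True the class imposes no restriction. *)
Theorem theorem3 (R : realType) (n : nat)
  (Omega : set 'cV[R]_n) (Lambda : set R)
  (f : 'cV[R]_n -> 'cV[R]_n) (V : 'cV[R]_n -> R) (W : 'cV[R]_n -> 'cV[R]_n)
  (Psi : 'cV[R]_n * R -> R) (L : R)
  (A : ('cV[R]_n -> 'cV[R]_n) -> ('cV[R]_n -> R) ->
       ('cV[R]_n -> 'cV[R]_n) -> Prop)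
  (Omega_compact : compact Omega) (Omega0 : Omega 0)
  (Lambda01 : `[0, 1] `<=` Lambda)
  (f_cont : {within Omega, continuous f})
  (V_cont : {within Omega, continuous V})
  (V01 : forall x, Omega x -> 0 <= V x <= 1)
  (W_cont : {within Omega, continuous W})
  (Psi_cont : {within Omega `*` Lambda, continuous Psi})
  (f0 : f 0 = 0)
  (L_gt0 : 0 < L)
  (Psi_lip : forall x, Omega x -> L.-lipschitz_Lambda (fun z => Psi (x, z)))
  (W_eq0 : forall x, Omega x -> (W x = 0 <-> x = 0))
  (fW_lim : exists l : R,
     (fun x => enorm (f x) / enorm (W x)) @ within Omega (0 : 'cV[R]_n)^' --> l)
  (Psi0 : forall z, Lambda z -> Psi (0, z) = 0)
  (WfPsi : forall x, Omega x ->
     (W x)^T *m f x = (enorm (W x) * Psi (x, V x))%:M)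
  (approx : forall delta : R, 0 < delta ->
     exists ftil Vhat What,
       A ftil Vhat What /\
       approximants Omega Lambda f V W delta ftil Vhat What) :
  forall eps : R, 0 < eps -> forall delta : R, 0 < delta ->
    exists ftil Vhat What,
      [/\ A ftil Vhat What,
          approximants Omega Lambda f V W delta ftil Vhat What,
          {within Omega, continuous (fhat Psi ftil Vhat What)} &
          (supnorm (@enorm R n) Omega
             (fun x => (f x - fhat Psi ftil Vhat What x)%R) <= eps%:E)%E].
Proof.
move=> eps eps0 delta delta0.
have {fW_lim} [l fW_lim] := fW_lim.
have [K K0 fWK] := enorm_ratio_bound Omega_compact f_cont W_cont f0 W_eq0 fW_lim.
have C0 : 0 < 2 + 2 * K + L by rewrite ltr_wpDl// addr_ge0// mulr_ge0.
(* The first entry keeps the approximants within [delta]; the second makes the error constant times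
   [d] at most [eps]. *)
pose d := Num.min delta (eps / (2 + 2 * K + L)).
have d0 : 0 < d by rewrite lt_min delta0 divr_gt0.
have dle : d <= delta by rewrite ge_min lexx.
have [ftil [Vhat [What [AfVW ]]]] := approx d d0.
move=> [[fc Vc Wc] [/supnorm_leP fd /supnorm_leP Vd /supnorm_leP Wd] ftil0 VL What0].
exists ftil, Vhat, What; split=> //.
- by split=> //; split; apply/supnorm_leP => x Ox; rewrite (le_trans _ dle)// (fd, Vd, Wd).
- exact: (within_fhat_continuous Psi_cont).
apply/supnorm_leP => x Ox; rewrite (@le_trans _ _ ((2 + 2 * K + L) * d))//; last first.
  by rewrite mulrC -ler_pdivlMr// ge_min lexx orbT.
(* [fhat_dist] divides by |W x|, so the origin is treated apart: there [f] and [fhat] both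
   vanish. *)
case: (eqVneq x 0) => [x0|x0].
  rewrite fhat_eq0 ?x0 ?f0 ?subrr ?enorm0 ?mulr_ge0 ?ltW//.
  by apply/What0 => //; rewrite -x0.
have Wx0 : W x != 0 by apply: contraNN x0 => /eqP/(W_eq0 x Ox)->.
have WfP : dotp (W x) (f x) = enorm (W x) * Psi (x, V x).
  by rewrite /dotp WfPsi// mxE.
apply: fhat_dist (WfP) _ (fd _ Ox) (Wd _ Ox) => //; first exact: fWK.
(* The Lipschitz bound needs both arguments in [Lambda]: V x lies in [0,1], and Vhat x in the image
   of [Omega]. *)
have := Psi_lip x Ox (V x, Vhat x); rewrite /=.
move=> h; apply: le_trans (h _) _.
  by split=> /=; [apply: Lambda01; rewrite /= in_itv/= V01|apply: VL; exists x].
by rewrite /= ler_pM2l// Vd.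
Qed.
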